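(* There exist $p,q>2$ satisfying either [$p>6$ and $4<q<\frac p2+1$] or [$2<p<6$ and $\frac p2+1<q<4$], and $\mu>0$, for which the problem $$\begin{cases} u''-|u|^{p-2}u=\lambda u & \text{on }\mathbb{R}\setminus\{0\},\\ u'(0^-)-u'(0^+)=|u(0)|^{q-2}u(0),\\ \|u\|_{L^2(\mathbb{R})}^2=\mu\end{cases}$$ admits two solutions $u_1,u_2\in H^1(\mathbb{R})$ (each with some $\lambda\geq0$, possibly different for the two) that are different up to a change of sign, i.e. $u_1\neq u_2$ and $u_1\neq -u_2$.
   Context: Functions are real-valued. $u'(0^-),u'(0^+)$ denote the left and right derivatives of $u$ at the origin. A solution of the problem at mass $\mu$ is a function $u\in H^1(\mathbb{R})$ for which there exists $\lambda\geq0$ such that the problem is satisfied; solutions are understood in the weak sense: $\int_{\mathbb{R}}u'\varphi'\,dx+\int_{\mathbb{R}}|u|^{p-2}u\varphi\,dx-|u(0)|^{q-2}u(0)\varphi(0)=-\lambda\int_{\mathbb{R}}u\varphi\,dx$ for every $\varphi\in H^1(\mathbb{R})$. *)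

(* Defs.v *)
From mathcomp Require Import all_boot all_order all_algebra.
From mathcomp Require Import all_classical all_reals all_analysis.

Set Implicit Arguments.
Unset Strict Implicit.
Unset Printing Implicit Defensive.
Import Order.TTheory GRing.Theory Num.Theory.
Import numFieldNormedType.Exports.
Local Open Scope classical_set_scope.
Local Open Scope ring_scope.

(* C^1_c(R) *)
Definition test_function (R : realType) (psi : R -> R) : Prop :=
  [/\ forall x : R, derivable psi x 1,
      continuous (derive1 psi)
    & compact (closure [set x : R | psi x != 0])].

(* Meaningful for locally integrable u and v (in particular in L^2), for
   which both integrals converge. *)
Definition weak_derivative (R : realType) (u v : R -> R) : Prop :=
  forall psi : R -> R, test_function psi ->
    \int[@lebesgue_measure R]_x (u x * derive1 psi x) =
    - \int[@lebesgue_measure R]_x (v x * psi x).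

(* An element of H^1(R) is represented by its unique continuous
   representative u, so that u 0 is meaningful and equality in H^1(R) is
   equality of functions; v is any representative of the weak derivative,
   which is determined only almost everywhere. *)
Definition H1_pair (R : realType) (u v : R -> R) : Prop :=
  [/\ continuous u,
      u \in Lfun (@lebesgue_measure R) 2%:E,
      v \in Lfun (@lebesgue_measure R) 2%:E
    & weak_derivative u v].

Definition H1 (R : realType) (u : R -> R) : Prop := exists v, H1_pair u v.

(* |t|^(r-2) t, for r > 2 *)
Definition signed_pow (R : realType) (r t : R) : R := `|t| `^ (r - 2) * t.

(* For u in H^1(R), the weak form on H^1(R) of
     u'' - |u|^(p-2) u = lambda u               on R \ {0},
     u'(0-) - u'(0+) = |u(0)|^(q-2) u(0).
   Here du and dphi range over all representatives of the weak derivatives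
   of u and phi; the integrals do not depend on them. *)
Definition weak_solution (R : realType) (p q lambda : R) (u : R -> R) : Prop :=
  forall du phi dphi : R -> R, H1_pair u du -> H1_pair phi dphi ->
    \int[@lebesgue_measure R]_x (du x * dphi x)
    + \int[@lebesgue_measure R]_x (signed_pow p (u x) * phi x)
    - signed_pow q (u 0) * phi 0
    = - lambda * \int[@lebesgue_measure R]_x (u x * phi x).

Definition solution_at_mass (R : realType) (p q mu : R) (u : R -> R) : Prop :=
  [/\ H1 u,
      exists2 lambda : R, 0 <= lambda & weak_solution p q lambda u
    & ('N[@lebesgue_measure R]_2%:E[EFin \o u] ^+ 2 = mu%:E)%E].

(* Main.v *)
(* For p = 4 the equation u'' = u^3 + lambda u with lambda = k^2 has, on x >= 0,
   the decaying solutions 4 k w E / (2 - w^2 E^2) with E = exp(-k x), and the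
   even extension has mass 8 k w^2 / (2 - w^2).  With q = 7/2 the jump condition
   determines k in terms of w, and the mass becomes (w^2 + 2)^2 / (2 w), which
   is not injective on (0, 1]: it takes the value 9/2 at w = 1 and at the root
   of w^3 + w^2 + 5 w - 4.  The two solutions differ at 0, where u = 9 / (4 w).

   The weak form quantifies over all pairs (phi, phi') in H^1, for which
   integration by parts against a C^1 function g on [a, b] is obtained by
   testing the definition of the weak derivative with g times a C^1 plateau
   approximating the indicator of [a, b]; with g = 1 this also gives the
   uniqueness of weak derivatives, by Lebesgue differentiation. *)
Require Import Defs.
From mathcomp Require Import all_boot all_order all_algebra.
From mathcomp Require Import all_classical all_reals all_analysis.
From mathcomp Require Import measurable_realfun ring lra.

Import Order.TTheory GRing.Theory Num.Theory.
Import numFieldNormedType.Exports.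
Local Open Scope classical_set_scope.
Local Open Scope ring_scope.

(** * Smooth plateaus *)

(** Away from 0 the function is locally [- y ^+ 2] or [y ^+ 2]; at 0 its difference quotient is the
    absolute value of the increment, which tends to 0. Shifted copies of this C^1 function make up
    the step below. *)
Lemma is_derive_mulr_norm (R : realType) (x : R) :
  is_derive x 1 (fun y : R => y * `|y|) (2 * `|x|).
Proof.
have [x0|x0|->] := ltgtP x 0.
- apply: (@near_eq_is_derive R R^o R^o (fun y : R => - y ^+ 2)).
    near=> y; rewrite ltr0_norm; first by ring.
    by near: y; exact: lt_nbhsl.
  rewrite ltr0_norm //.
  by apply: is_derive_eq; rewrite -[_ *: _]/(_ * _) /=; ring.
- apply: (@near_eq_is_derive R R^o R^o (fun y : R => y ^+ 2)).
    near=> y; rewrite gtr0_norm; first by ring.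
    by near: y; exact: lt_nbhsr.
  rewrite gtr0_norm //.
  by apply: is_derive_eq; rewrite -[_ *: _]/(_ * _) /=; ring.
- have lim0 : (fun h : R => h^-1 *: ((h *: (1:R) + 0) * `|h *: (1:R) + 0|
      - 0 * `|0 : R|)) @ (0:R)^' --> (0:R).
    apply/cvgrPdist_lt => e e0; near=> h.
    have h0 : h != 0 by near: h; exact: nbhs_dnbhs_neq.
    rewrite mul0r addr0 -[h *: 1]/(h * 1) mulr1 subr0 -[_ *: _]/(_ * _) mulrA mulVf//.
    rewrite mul1r sub0r normrN normr_id -[h]subr0 distrC.
    by near: h; apply: nbhs_dnbhs; exact: (nbhsx_ballx (0:R)).
  apply: DeriveDef.
    by apply/cvg_ex; exists 0.
  by rewrite normr0 mulr0; apply/cvg_lim.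
Unshelve. all: by end_near. Qed.

Section smooth_step.
Variable R : realType.
Implicit Types x y : R.

(* A C^1 step, from 0 at 0 to 1 at 1, in closed form: its derivative is the
   tent function of height 2 supported on [0, 1]. *)
Definition smooth_step y : R :=
  2^-1 + y * `|y| - 2 * ((y - 2^-1) * `|y - 2^-1|) + (y - 1) * `|y - 1|.

Definition tent y : R := 2 * `|y| - 4 * `|y - 2^-1| + 2 * `|y - 1|.

Lemma smooth_step_le0 y : y <= 0 -> smooth_step y = 0.
Proof.
move=> y0; rewrite /smooth_step !ler0_norm; [|lra..].
by field.
Qed.

Lemma smooth_step_ge1 y : 1 <= y -> smooth_step y = 1.
Proof.
move=> y1; rewrite /smooth_step !ger0_norm; [|lra..].
by field.
Qed.

Lemma tent_out y : y <= 0 \/ 1 <= y -> tent y = 0.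
Proof.
case=> yb; rewrite /tent; [rewrite !ler0_norm|rewrite !ger0_norm]; by [lra|field].
Qed.

Lemma tent_ge0 y : 0 <= tent y.
Proof.
rewrite /tent; case: (ler0P y) => ?; case: (ler0P (y - 2^-1)) => ?;
case: (ler0P (y - 1)) => ?; lra.
Qed.

Lemma smooth_step_itv y : 0 <= smooth_step y <= 1.
Proof.
rewrite /smooth_step; case: (ler0P y) => ?; case: (ler0P (y - 2^-1)) => ?;
case: (ler0P (y - 1)) => ?; apply/andP; split; nra.
Qed.

Lemma is_derive_smooth_step y : is_derive y 1 smooth_step (tent y).
Proof.
have D c : is_derive y 1 (fun z : R => (z - c) * `|z - c|) (2 * `|y - c|).
  have dc : is_derive y 1 (fun z : R => z - c) 1.
    by apply: is_derive_eq; rewrite subr0.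
  have := @is_derive1_comp R (fun z : R => z * `|z|) (fun z => z - c) y _ _
    (is_derive_mulr_norm R (y - c)) dc.
  by rewrite mulr1.
have := D 2^-1; have := D 1; have := @is_derive_mulr_norm R y => ? ? ?.
apply: is_derive_eq.
rewrite /tent.
by rewrite -[2 *: _]/(_ * _); ring.
Qed.

Lemma continuous_tent : continuous tent.
Proof.
move=> y; rewrite /tent; apply: cvgD; first apply: cvgB.
- by apply: cvgMr; apply: cvg_norm.
- by apply: cvgMr; apply: cvg_norm; apply: cvgB => //; exact: cvg_cst.
- by apply: cvgMr; apply: cvg_norm; apply: cvgB => //; exact: cvg_cst.
Qed.

End smooth_step.
Arguments smooth_step {R} y.
Arguments tent {R} y.

Lemma is_derive_continuous (R : realType) (f : R -> R) (x df : R) :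
  is_derive x 1 f df -> {for x, continuous f}.
Proof.
move=> [dfx _]; apply/differentiable_continuous; exact/derivable1_diffP.
Qed.

Section plateau.
Variables (R : realType) (a b h : R).
Hypotheses (h0 : 0 < h) (hab : 1 <= h * (b - a)).

(* Supported in [a, b], so that g * plateau is C^1 on the whole line as soon as g
   is C^1 at the points of [a, b]. *)
Definition plateau (x : R) : R :=
  smooth_step (h * (x - a)) - smooth_step (h * (x - b) + 1).

Definition dplateau (x : R) : R :=
  h * tent (h * (x - a)) - h * tent (h * (x - b) + 1).

(** The rising ramp occupies [a, a + 1/h] and the falling one [b - 1/h, b], the shift by 1 making
    the latter end at b. By [hab] neither ramp is longer than [a, b], so outside it the two steps
    are both 0 or both 1. *)
Lemma plateau_out x : x <= a \/ b <= x -> plateau x = 0.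
Proof.
move=> [xa|bx]; rewrite /plateau.
  have := mulr_ge0 (ltW h0) (_ : 0 <= a - x); rewrite subr_ge0 => /(_ xa) hx.
  by rewrite !smooth_step_le0 ?subrr//; move: hab hx; lra.
have := mulr_ge0 (ltW h0) (_ : 0 <= x - b); rewrite subr_ge0 => /(_ bx) hx.
by rewrite !smooth_step_ge1 ?subrr//; move: hab hx; lra.
Qed.

Lemma dplateau_out x : x <= a \/ b <= x -> dplateau x = 0.
Proof.
move=> [xa|bx]; rewrite /dplateau.
  have := mulr_ge0 (ltW h0) (_ : 0 <= a - x); rewrite subr_ge0 => /(_ xa) hx.
  by rewrite !tent_out ?subrr//; left; move: hab hx; lra.
have := mulr_ge0 (ltW h0) (_ : 0 <= x - b); rewrite subr_ge0 => /(_ bx) hx.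
by rewrite !tent_out ?subrr//; right; move: hab hx; lra.
Qed.

Lemma plateau_norm_le1 x : `|plateau x| <= 1.
Proof.
have /andP[? ?] := smooth_step_itv R (h * (x - a)).
have /andP[? ?] := smooth_step_itv R (h * (x - b) + 1).
by rewrite ler_norml /plateau; apply/andP; split; lra.
Qed.

Lemma is_derive_smooth_step_affine (p q r x : R) :
  is_derive x 1 (fun y => smooth_step (p * (y - q) + r))
    (p * tent (p * (x - q) + r)).
Proof.
have D : is_derive x 1 (fun y : R => p * (y - q) + r) p.
  by apply: is_derive_eq; rewrite subr0 addr0 -[_ *: _]/(_ * _) mulr1.
have := @is_derive1_comp R smooth_step _ x _ _
  (is_derive_smooth_step R (p * (x - q) + r)) D.
by rewrite mulrC.
Qed.

Lemma is_derive_plateau (x : R) : is_derive x 1 plateau (dplateau x).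
Proof.
have D1 : is_derive x 1 (fun y => smooth_step (h * (y - a)))
    (h * tent (h * (x - a))).
  have := is_derive_smooth_step_affine h a 0 x; rewrite addr0.
  by congr (is_derive _ _ _ _); apply/funext => y; rewrite addr0.
have D2 := is_derive_smooth_step_affine h b 1 x.
exact: is_deriveB.
Qed.

Lemma continuous_tent_affine (p q r : R) :
  continuous (fun x => tent (p * (x - q) + r)).
Proof.
move=> x; apply: (@continuous_comp _ _ _ (fun x => p * (x - q) + r) tent).
  apply: cvgD; last exact: cvg_cst.
  by apply: cvgMr; apply: cvgB => //; exact: cvg_cst.
exact: continuous_tent.
Qed.

Lemma continuous_dplateau : continuous dplateau.
Proof.
move=> x; apply: cvgB; apply: cvgMr.
  have := continuous_tent_affine h a 0 x.
  by congr (continuous_at _ _); apply/funext => y; rewrite addr0.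
exact: (continuous_tent_affine h b 1).
Qed.

Lemma continuous_plateau : continuous plateau.
Proof.
by move=> x; apply: (is_derive_continuous _ _ _ _ (is_derive_plateau x)).
Qed.

Section test.
Variables g g' : R -> R.
Hypothesis dg : forall x, a <= x <= b -> is_derive x 1 g (g' x).
Hypothesis cg' : forall x, a <= x <= b -> {for x, continuous g'}.

Let near_out x : ~~ (a <= x <= b) -> \forall y \near x, y <= a \/ b <= y.
Proof.
rewrite negb_and -!ltNge => /orP[xa|bx].
  by near=> y; left; apply/ltW; near: y; exact: lt_nbhsl.
by near=> y; right; apply/ltW; near: y; exact: lt_nbhsr.
Unshelve. all: by end_near. Qed.

(** Nothing is known of [g] off the closed interval, but every point there has a neighbourhood on
    which the plateau, hence the product, vanishes. *)
Lemma is_derive_mul_plateau (x : R) : is_derive x 1 (fun y => g y * plateau y)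
  (g' x * plateau x + g x * dplateau x).
Proof.
have [xab|/near_out xab] := boolP (a <= x <= b).
  have dgx := dg x xab; have := is_derive_plateau x => dT.
  have := @is_deriveM R R^o g plateau x 1 _ _ dgx dT.
  by move=> /is_derive_eq; apply; rewrite -!/(_ * _) addrC mulrC.
have xo := nbhs_singleton xab.
rewrite plateau_out// dplateau_out//.
rewrite !mulr0 addr0.
apply: (@near_eq_is_derive R R^o R^o (cst 0)).
by near=> y; rewrite plateau_out ?mulr0//; near: y.
Unshelve. all: by end_near. Qed.

Lemma test_function_mul_plateau : test_function (fun y => g y * plateau y).
Proof.
split.
- by move=> x; have [] := is_derive_mul_plateau x.
- rewrite (_ : derive1 _ = (fun x => g' x * plateau x + g x * dplateau x)).
    move=> x; have [xab|/near_out xab] := boolP (a <= x <= b).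
      apply: cvgD; apply: cvgM.
      + exact: cg'.
      + exact: continuous_plateau.
      + exact: (is_derive_continuous _ _ _ _ (dg x xab)).
      + exact: continuous_dplateau.
    apply: (@near_cst_continuous _ _ (0 : R)).
    by near=> y; rewrite plateau_out ?dplateau_out ?mulr0 ?addr0//; near: y.
  apply/funext => x; rewrite derive1E.
  by have := is_derive_mul_plateau x => ?; rewrite derive_val.
- apply: (@subclosed_compact _ _ `[a, b]).
  + exact: closed_closure.
  + exact: segment_compact.
  + have /closure_id -> := @itv_closed _ R a b.
    apply: closureS => x /=; rewrite in_itv/=.
    have [//|/near_out/nbhs_singleton xab] := boolP (a <= x <= b).
    by rewrite plateau_out// mulr0 eqxx.
Unshelve. all: by end_near. Qed.

End test.
End plateau.

(** * Integration on the real line *)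

Section real_integral.
Variable R : realType.
Notation mu := (@lebesgue_measure R).
Implicit Types (f g F : R -> R) (a b M : R).

Lemma continuous_at_itv f a b :
  (forall x, a <= x <= b -> {for x, continuous f}) ->
  {within `[a, b], continuous f}.
Proof.
move=> cf; apply: continuous_in_subspaceT => x /set_mem /=.
by rewrite in_itv/=; exact: cf.
Qed.

Lemma continuous_itv_integrable f a b :
  (forall x, a <= x <= b -> {for x, continuous f}) ->
  mu.-integrable `[a, b] (EFin \o f).
Proof.
move=> /continuous_at_itv; apply: continuous_compact_integrable.
exact: segment_compact.
Qed.

Lemma continuous_itv_bounded f a b :
  (forall x, a <= x <= b -> {for x, continuous f}) ->
  exists M, forall x, a <= x <= b -> `|f x| <= M.
Proof.
move=> cf; have [ab|ab] := leP a b; last first.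
  by exists 0 => x /andP[ax xb]; move: ab; rewrite ltNge (le_trans ax xb).
have cnf : {within `[a, b], continuous (fun x => `|f x|)}.
  by apply: continuous_at_itv => x /cf; exact: cvg_norm.
have [c _ cmax] := EVT_max ab cnf.
by exists `|f c| => x xab; apply: cmax; rewrite in_itv.
Qed.

Lemma Rintegral_derive F f a b : a < b ->
  (forall x, a <= x <= b -> is_derive x 1 F (f x)) ->
  (forall x, a <= x <= b -> {for x, continuous f}) ->
  \int[mu]_(x in `[a, b]) f x = F b - F a.
Proof.
move=> ab dF cf.
have cF x : a <= x <= b -> {for x, continuous F}.
  by move=> /dF; exact: is_derive_continuous.
rewrite /Rintegral (@continuous_FTC2 _ _ F)//.
- exact: continuous_at_itv.
- split.
  + by move=> x /[!in_itv]/= /andP[/ltW ax /ltW xb]; have [] := dF x; rewrite ?ax.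
  + by apply: cvg_at_right_filter; apply: cF; rewrite lexx ltW.
  + by apply: cvg_at_left_filter; apply: cF; rewrite lexx ltW.
- move=> x /[!in_itv]/= /andP[/ltW ax /ltW xb]; rewrite derive1E.
  by have := dF x; rewrite ax xb => /(_ isT) ?; rewrite derive_val.
Qed.

Lemma Rintegral_support (D : set R) f :
  (forall x, ~ D x -> f x = 0) -> \int[mu]_x f x = \int[mu]_(x in D) f x.
Proof.
move=> f0; rewrite [RHS]Rintegral_mkcond; apply: eq_Rintegral => x _.
by rewrite patchE; case: ifPn => // /negP xD; apply: f0 => Dx; apply: xD; rewrite inE.
Qed.

Lemma Rintegral_itv_oo_cc f a b : mu.-integrable `[a, b] (EFin \o f) ->
  \int[mu]_(x in `]a, b[) f x = \int[mu]_(x in `[a, b]) f x.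
Proof.
move=> intf; rewrite Rintegral_itv_obnd_cbnd; last first.
  apply: integrableS intf => //; apply: subset_itv; rewrite ?bnd_simp//.
rewrite Rintegral_itv_bndo_bndc//.
by apply: integrableS intf => //; apply: subset_itv; rewrite ?bnd_simp.
Qed.

Lemma le_integrableR (D : set R) f g : measurable D -> measurable_fun D f ->
  (forall x, D x -> `|f x| <= g x) -> mu.-integrable D (EFin \o g) ->
  mu.-integrable D (EFin \o f).
Proof.
move=> mD mf fg.
apply: (@le_integrable _ _ _ mu D mD (EFin \o f) (EFin \o g)).
  exact/measurable_EFinP.
move=> x Dx /=; rewrite lee_fin.
by apply: le_trans (fg _ Dx) _; exact: ler_norm.
Qed.

Lemma integrableDR (D : set R) f g : measurable D ->
  mu.-integrable D (EFin \o f) -> mu.-integrable D (EFin \o g) ->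
  mu.-integrable D (EFin \o (fun x => f x + g x)).
Proof.
by move=> mD; exact: (@integrableD _ _ _ mu D mD (EFin \o f) (EFin \o g)).
Qed.

Lemma integrableZR (D : set R) (c : R) f : measurable D ->
  mu.-integrable D (EFin \o f) -> mu.-integrable D (EFin \o (fun x => c * f x)).
Proof. by move=> mD; exact: (@integrableZl _ _ _ mu D mD c (EFin \o f)). Qed.

Lemma integrableBR (D : set R) f g : measurable D ->
  mu.-integrable D (EFin \o f) -> mu.-integrable D (EFin \o g) ->
  mu.-integrable D (EFin \o (fun x => f x - g x)).
Proof.
by move=> mD; exact: (@integrableB _ _ _ mu D mD (EFin \o f) (EFin \o g)).
Qed.

Lemma integrable_mul_bounded (D : set R) f g M : measurable D ->
  mu.-integrable D (EFin \o f) -> measurable_fun D g ->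
  (forall x, D x -> `|g x| <= M) ->
  mu.-integrable D (EFin \o (fun x => f x * g x)).
Proof.
move=> mD intf mg gM.
have mf : measurable_fun D f by apply/measurable_EFinP; exact: measurable_int intf.
apply: (le_integrableR D _ (fun x => M * `|f x|)) => //.
- exact: measurable_funM.
- by move=> x Dx; rewrite mulrC normrM; apply: ler_wpM2r => //; exact: gM.
- by apply: integrableZR => //; exact: integrable_norm.
Qed.

Lemma continuous_itv_measurable f a b :
  (forall x, a <= x <= b -> {for x, continuous f}) -> measurable_fun `[a, b] f.
Proof.
by move=> /continuous_itv_integrable /measurable_int /measurable_EFinP.
Qed.

Lemma integrable_mul_continuous f g a b :
  mu.-integrable `[a, b] (EFin \o f) ->
  (forall x, a <= x <= b -> {for x, continuous g}) ->
  mu.-integrable `[a, b] (EFin \o (fun x => f x * g x)).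
Proof.
move=> intf cg; have [M gM] := continuous_itv_bounded _ _ _ cg.
apply: (@integrable_mul_bounded _ _ _ M) => //.
- exact: continuous_itv_measurable.
Qed.

(** Meant for integrands that contain a sign and may jump at 0: the left-hand formula is required
    only for x < 0, and the point 0 is put back as a null set. *)
Lemma Rintegral_itv_split0 (N : R) F FL FR : 0 < N ->
  mu.-integrable `[- N, N] (EFin \o F) ->
  (forall x, - N <= x < 0 -> F x = FL x) ->
  (forall x, 0 <= x <= N -> F x = FR x) ->
  \int[mu]_(x in `[- N, N]) F x =
  \int[mu]_(x in `[- N, 0]) FL x + \int[mu]_(x in `[0, N]) FR x.
Proof.
move=> N0 iF FEL FER.
have E : `[- N, N]%classic = `[- N, 0[ `|` `[0, N] :> set R.
  by rewrite -itv_bndbnd_setU// bnd_simp ?oppr_le0 ltW.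
have iL : mu.-integrable `[- N, 0[ (EFin \o F).
  by apply: integrableS iF => //; rewrite E; exact: subsetUl.
rewrite E Rintegral_setU//; first congr (_ + _).
- rewrite (eq_Rintegral mu (g := FL)); last first.
    by move=> x /[!inE]/= /[!in_itv]/=; exact: FEL.
  apply: Rintegral_itv_bndo_bndc.
  apply: (@eq_integrable _ _ _ mu _ (measurable_itv _) (EFin \o F)) => //.
  by move=> x /[!inE]/= /[!in_itv]/= xN; rewrite FEL.
- by apply: eq_Rintegral => x /[!inE]/= /[!in_itv]/=; exact: FER.
- by rewrite -E.
- apply/disj_setPS => x [] /=; rewrite !in_itv/= => /andP[_ x0] /andP[].
  by rewrite leNgt x0.
Qed.

Lemma Rintegral_dominated_cvg (D : set R) (f_ : nat -> R -> R) f g :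
  measurable D -> (forall n, measurable_fun D (f_ n)) ->
  (forall x, D x -> f_ ^~ x @ \oo --> f x) ->
  mu.-integrable D (EFin \o g) ->
  (forall n x, D x -> `|f_ n x| <= g x) ->
  (fun n => \int[mu]_(x in D) f_ n x) @ \oo --> \int[mu]_(x in D) f x.
Proof.
move=> mD mf_ f_f intg f_g.
have mf : measurable_fun D f.
  by apply: (@measurable_fun_cvg _ _ _ D f_).
have ff : \forall x \ae mu, D x -> (EFin \o f_ n) x @[n --> \oo] --> (EFin \o f) x.
  by apply: aeW => x /f_f fx; apply: cvg_EFin => //; exact: nearW.
have fg : \forall x \ae mu, forall n, D x ->
    (`|(EFin \o f_ n) x| <= (EFin \o g) x)%E.
  by apply: aeW => x n Dx /=; rewrite lee_fin; exact: f_g.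
have [intf _ cvg] := @dominated_convergence _ _ _ mu D mD
  (fun n => EFin \o f_ n) (EFin \o f) (EFin \o g)
  (fun n => (measurable_EFinP _ _).2 (mf_ n)) ((measurable_EFinP _ _).2 mf)
  ff intg fg.
apply: fine_cvg; rewrite fineK//; exact: integrable_fin_num.
Qed.

End real_integral.

(** * Weak derivatives *)

Section delta.
Variable R : realType.
Notation mu := (@lebesgue_measure R).

(** [W n] is an approximate identity at [c], which may be an endpoint of [a, b]. Since its mass is
    1, the error is the integral of (F c - F x) W n x, at most [e] once the radius [r n] is below
    the modulus of continuity of [F] at [c]. *)
Lemma Rintegral_delta_cvg (a b c : R) (F : R -> R) (W : nat -> R -> R)
    (r : nat -> R) :
  (forall x, a <= x <= b -> {for x, continuous F}) -> {for c, continuous F} ->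
  (forall n, continuous (W n)) -> (forall n x, 0 <= W n x) ->
  (forall n, \int[mu]_(x in `[a, b]) W n x = 1) ->
  (forall n x, W n x != 0 -> `|c - x| <= r n) -> r @ \oo --> (0 : R) ->
  (fun n => \int[mu]_(x in `[a, b]) (F x * W n x)) @ \oo --> F c.
Proof.
move=> cF cFc cW W0 W1 Wr r0; apply/cvgrPdist_le => e e0.
have /cvgrPdist_le/(_ _ e0) [d /= d0 dF] := cFc.
have /cvgrPdist_lt/(_ _ d0) := r0; apply: filterS => n.
rewrite sub0r normrN => rd.
have iW : mu.-integrable `[a, b] (EFin \o W n).
  by apply: continuous_itv_integrable => x _; exact: cW.
have iFW : mu.-integrable `[a, b] (EFin \o (fun x => F x * W n x)).
  by apply: continuous_itv_integrable => x /cF cFx; apply: cvgM => //; exact: cW.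
have iD : mu.-integrable `[a, b] (EFin \o (fun x => (F c - F x) * W n x)).
  apply: continuous_itv_integrable => x /cF cFx; apply: cvgM => //; last exact: cW.
  by apply: cvgB => //; exact: cvg_cst.
have -> : F c - \int[mu]_(x in `[a, b]) (F x * W n x) =
    \int[mu]_(x in `[a, b]) ((F c - F x) * W n x).
  rewrite -[F c in LHS]mulr1 -(W1 n) -RintegralZl// -RintegralB//; last first.
    exact: integrableZR.
  by apply: eq_Rintegral => x _; rewrite mulrBl.
have mI : measurable (`[a, b] : set R) by exact: measurable_itv.
have := @le_normr_Rintegral _ _ _ mu _ _ mI iD => /le_trans; apply.
rewrite -[e]mulr1 -(W1 n) -RintegralZl//; apply: le_Rintegral => //.
- exact: (integrable_norm iD).
- exact: integrableZR.
- move=> x _; rewrite normrM [`|W n x|]ger0_norm//.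
  have [->|/Wr cx] := eqVneq (W n x) 0; first by rewrite !mulr0.
  apply: ler_wpM2r => //; apply: dF => /=.
  by apply: le_lt_trans cx _; apply: le_lt_trans rd; exact: ler_norm.
Qed.

End delta.

(** * Integration by parts on a bounded interval *)

Section H1_by_parts.
Variables (R : realType) (phi dphi g g' : R -> R) (a b : R).
Notation mu := (@lebesgue_measure R).
Hypothesis ab : a < b.
Hypothesis phiH1 : H1_pair phi dphi.
Hypothesis dg : forall x, a <= x <= b -> is_derive x 1 g (g' x).
Hypothesis cg' : forall x, a <= x <= b -> {for x, continuous g'}.

(** The ramps get width (b - a) / (n + 1), which fits in [a, b] already for n = 0. *)
Let h (n : nat) : R := n.+1%:R / (b - a).
Let h_gt0 n : 0 < h n.
Proof. by rewrite divr_gt0// subr_gt0. Qed.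
Let hab n : h n * (b - a) = n.+1%:R.
Proof. by rewrite divfK// subr_eq0 gt_eqF. Qed.
Let hab1 n : 1 <= h n * (b - a).
Proof. by rewrite hab ler1n. Qed.

(** The bumps with (c, s) = (a, 0) and (b, 1) are the two terms whose difference is [dplateau]. *)
Let W (c s : R) n x : R := h n * tent (h n * (x - c) + s).

(** On a bounded interval 1 + f^2 is integrable and dominates the absolute value of f. *)
Lemma Lfun2_integrable_itv (f : R -> R) (c d : R) : f \in Lfun mu 2%:E ->
  mu.-integrable `[c, d] (EFin \o f).
Proof.
move=> f2; have mf : measurable_fun setT f.
  by move: f2; rewrite inE => /andP[/[!inE]].
apply: (le_integrableR _ _ _ (fun x => 1 + f x ^+ 2)) => //.
- exact: measurable_funTS.
- move=> x _; rewrite -[f x ^+ 2]sqrrN; case: (ler0P (f x)) => ?; nra.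
- apply: integrableDR => //.
    by apply: (continuous_itv_integrable _ (cst 1)) => x _; exact: cvg_cst.
  by apply: integrableS (Lfun2_integrable_sqr f2).
Qed.

Let cg x : a <= x <= b -> {for x, continuous g}.
Proof. by move=> /dg; exact: is_derive_continuous. Qed.

Let cphi x : {for x, continuous phi}.
Proof. by case: phiH1 => /(_ x). Qed.

Let near_h (e : R) : 0 < e -> \forall n \near \oo, 1 <= h n * e.
Proof.
move=> e0; near=> n; rewrite /h mulrAC ler_pdivlMr ?subr_gt0// mul1r.
rewrite -ler_pdivrMr//; apply: (@le_trans _ _ n%:R); last by rewrite ler_nat.
by near: n; exact: nbhs_infty_ger.
Unshelve. all: by end_near. Qed.

Let plateau_cvg1 x : a < x < b ->
  (fun n => plateau R a b (h n) x) @ \oo --> (1 : R).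
Proof.
move=> /andP[ax xb]; apply: cvg_near_cst.
near=> n; rewrite /plateau smooth_step_ge1 ?smooth_step_le0 ?subr0//.
- have : 1 <= h n * (b - x) by near: n; apply: near_h; rewrite subr_gt0.
  by lra.
- by near: n; apply: near_h; rewrite subr_gt0.
Unshelve. all: by end_near. Qed.

Let mul_plateau_cvg (F : R -> R) : mu.-integrable `[a, b] (EFin \o F) ->
  (fun n => \int[mu]_(x in `[a, b]) (F x * plateau R a b (h n) x)) @ \oo -->
  \int[mu]_(x in `[a, b]) F x.
Proof.
move=> iF.
have iFT n : mu.-integrable `[a, b] (EFin \o (fun x => F x * plateau R a b (h n) x)).
  by apply: integrable_mul_continuous => // x _; exact: continuous_plateau.
(* At a and b every plateau is 0 and does not tend to 1, so dominated convergence is applied on the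
   open interval. *)
rewrite -Rintegral_itv_oo_cc//.
under eq_fun do rewrite -Rintegral_itv_oo_cc//.
have oo_cc : `]a, b[ `<=` `[a, b] by apply: subset_itv; rewrite bnd_simp.
apply: (Rintegral_dominated_cvg _ _ _ _ (fun x => `|F x|)) => //.
- move=> n; have := iFT n => /measurable_int/measurable_EFinP.
  exact: measurable_funS.
- move=> x; rewrite /= in_itv/= => /plateau_cvg1 T1.
  by rewrite -[X in _ --> X]mulr1; apply: cvgMr.
- by apply: integrable_norm; apply: integrableS iF.
- move=> n x _; rewrite normrM ler_piMr//; exact: plateau_norm_le1.
Qed.

Let r_cvg0 : (fun n => (b - a) / n.+1%:R) @ \oo --> (0 : R).
Proof.
by rewrite -[X in _ --> X](mulr0 (b - a)); apply: cvgMr; exact: cvg_harmonic.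
Qed.

Let W_continuous c s n : continuous (W c s n).
Proof. by move=> x; apply: cvgMr; exact: continuous_tent_affine. Qed.

Let W_ge0 c s n x : 0 <= W c s n x.
Proof. by rewrite mulr_ge0 ?tent_ge0// ltW. Qed.

Let Rintegral_W c s n :
  \int[mu]_(x in `[a, b]) W c s n x =
  smooth_step (h n * (b - c) + s) - smooth_step (h n * (a - c) + s).
Proof.
exact: (@Rintegral_derive R (fun x => smooth_step (h n * (x - c) + s)) (W c s n)
  a b ab (fun x _ => is_derive_smooth_step_affine R (h n) c s x)
  (fun x _ => W_continuous c s n x)).
Qed.

Let W_cvg (F : R -> R) (c s : R) :
  (forall x, a <= x <= b -> {for x, continuous F}) -> a <= c <= b ->
  (c = a /\ s = 0) \/ (c = b /\ s = 1) ->
  (fun n => \int[mu]_(x in `[a, b]) (F x * W c s n x)) @ \oo --> F c.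
Proof.
move=> cF cab cs.
apply: (Rintegral_delta_cvg _ _ _ _ _ _ (fun n => (b - a) / n.+1%:R)) => //.
- exact: cF.
(* Although [c] is an endpoint, the bump lies on the inner side of it, so all of its mass falls in
   [a, b]. *)
- move=> n; rewrite Rintegral_W; case: cs => -[-> ->].
    by rewrite subrr mulr0 addr0 smooth_step_ge1 ?smooth_step_le0 ?subr0// addr0.
  rewrite subrr mulr0 add0r smooth_step_ge1 ?smooth_step_le0 ?subr0//.
  by have := hab1 n; lra.
- move=> n x Wn0; have hn := h_gt0 n.
  have : 0 < h n * (x - c) + s < 1.
    apply: contraNT Wn0; rewrite negb_and -!leNgt => /orP yo.
    by rewrite /W tent_out ?mulr0.
  have -> : (b - a) / n.+1%:R = (h n)^-1 by rewrite /h invf_div.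
  rewrite -[_^-1]mul1r ler_pdivlMr//.
  rewrite -[X in _ * X <= _](gtr0_norm hn) -normrM.
  rewrite ler_norml => /andP[? ?]; apply/andP.
  by case: cs => -[_ s1]; split; nra.
Qed.

Theorem H1_integration_by_parts :
  \int[mu]_(x in `[a, b]) (g x * dphi x) =
  g b * phi b - g a * phi a - \int[mu]_(x in `[a, b]) (g' x * phi x).
Proof.
case: (phiH1) => _ _ dphi2 wd.
pose T n := plateau R a b (h n).
have cgphi x : a <= x <= b -> {for x, continuous (fun x => g x * phi x)}.
  by move=> xab; apply: cvgM; [exact: cg|exact: cphi].
have cg'phi x : a <= x <= b -> {for x, continuous (fun x => g' x * phi x)}.
  by move=> xab; apply: cvgM; [exact: cg'|exact: cphi].
have igd : mu.-integrable `[a, b] (EFin \o (fun x => dphi x * g x)).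
  by apply: integrable_mul_continuous => //; exact: Lfun2_integrable_itv.
have ig' : mu.-integrable `[a, b] (EFin \o (fun x => g' x * phi x)).
  exact: continuous_itv_integrable.
(* The weak derivative tested with g times the n-th plateau: the derivative of the plateau
   contributes a bump at a and minus a bump at b, which become the boundary terms as n grows. *)
have key n : \int[mu]_(x in `[a, b]) (g' x * phi x * T n x) +
    (\int[mu]_(x in `[a, b]) (g x * phi x * W a 0 n x) -
     \int[mu]_(x in `[a, b]) (g x * phi x * W b 1 n x)) =
    - \int[mu]_(x in `[a, b]) (dphi x * g x * T n x).
  have out x : ~ `[a, b]%classic x -> x <= a \/ b <= x.
    rewrite /= in_itv/= => /negP; rewrite negb_and -!ltNge.
    by move=> /orP[] /ltW; [left|right].
  have := wd _ (test_function_mul_plateau R a b (h n) (h_gt0 n) (hab1 n) g g' dg cg').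
  have -> : derive1 (fun y => g y * plateau R a b (h n) y) =
      (fun x => g' x * T n x + g x * dplateau R a b (h n) x).
    apply/funext => x; rewrite derive1E.
    have := is_derive_mul_plateau R a b (h n) (h_gt0 n) (hab1 n) g g' dg x => ?.
    by rewrite derive_val.
  rewrite (Rintegral_support _ `[a, b]) => [|x /out xo]; last first.
    by rewrite /T plateau_out// dplateau_out// !mulr0 addr0 mulr0.
  rewrite [X in _ = - X -> _](Rintegral_support _ `[a, b]) => [|x /out xo]; last first.
    by rewrite plateau_out// !mulr0.
  have iW c r : mu.-integrable `[a, b] (EFin \o (fun x => g x * phi x * W c r n x)).
    apply: continuous_itv_integrable => x /cgphi ?.
    by apply: cvgM => //; exact: W_continuous.
  have iT : mu.-integrable `[a, b] (EFin \o (fun x => g' x * phi x * T n x)).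
    by apply: integrable_mul_continuous => // x _; exact: continuous_plateau.
  rewrite -RintegralB// -RintegralD//; last exact: integrableBR.
  move=> E; transitivity (\int[mu]_(x in `[a, b])
    (phi x * (g' x * T n x + g x * dplateau R a b (h n) x))).
    by apply: eq_Rintegral => x _; rewrite /dplateau /W addr0; ring.
  by rewrite E; congr (- _); apply: eq_Rintegral => x _; rewrite mulrA.
have Wa := W_cvg _ a 0 cgphi; have Wb := W_cvg _ b 1 cgphi.
rewrite !lexx (ltW ab) in Wa Wb.
have {}Wa := Wa isT (or_introl (conj erefl erefl)).
have {}Wb := Wb isT (or_intror (conj erefl erefl)).
have L := cvgD (mul_plateau_cvg _ ig') (cvgB Wa Wb).
have Rl := cvgN (mul_plateau_cvg _ igd).
pose Z n := \int[mu]_(x in `[a, b]) (g' x * phi x * T n x) +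
    (\int[mu]_(x in `[a, b]) (g x * phi x * W a 0 n x) -
     \int[mu]_(x in `[a, b]) (g x * phi x * W b 1 n x)).
have ZL : Z @ \oo --> \int[mu]_(x in `[a, b]) (g' x * phi x) +
    (g a * phi a - g b * phi b) by exact: L.
have ZR : Z @ \oo --> - \int[mu]_(x in `[a, b]) (dphi x * g x).
  by rewrite /Z; under eq_fun do rewrite key; exact: Rl.
have := @cvg_unique R (@Rhausdorff R) (Z @ \oo) _ _ _ ZL ZR.
have -> : \int[mu]_(x in `[a, b]) (g x * dphi x) =
    \int[mu]_(x in `[a, b]) (dphi x * g x).
  by apply: eq_Rintegral => x _; rewrite mulrC.
by move=> E; rewrite -[LHS]opprK -E; ring.
Qed.

End H1_by_parts.

(** * Almost everywhere uniqueness of weak derivatives *)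

Section weak_derivative.
Variable R : realType.
Notation mu := (@lebesgue_measure R).

Lemma Lfun_measurable (f : R -> R) (p : \bar R) :
  f \in Lfun mu p -> measurable_fun setT f.
Proof. by rewrite inE => /andP[/[!inE]]. Qed.

Lemma Lfun2_locally_integrable (f : R -> R) : f \in Lfun mu 2%:E ->
  locally_integrable setT f.
Proof.
move=> f2; split; [exact: Lfun_measurable f2|exact: openT|move=> K _ cK].
have [M [_ KM]] := compact_bounded cK.
have KI : K `<=` `[- (M + 1), M + 1].
  by move=> x Kx /=; rewrite in_itv/= -ler_norml; apply: KM => //; rewrite ltrDl.
have : mu.-integrable K (EFin \o f).
  apply: integrableS (Lfun2_integrable_itv _ _ (- (M + 1)) (M + 1) f2) => //.
  exact: compact_measurable.
by move=> /integrableP[].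
Qed.

Lemma weak_derivative_itv (u du : R -> R) (a b : R) : a < b -> H1_pair u du ->
  \int[mu]_(x in `[a, b]) du x = u b - u a.
Proof.
move=> ab udu.
have := H1_integration_by_parts R u du (cst 1) (cst 0) a b ab udu.
move=> /(_ (fun x _ => is_derive_cst (1 : R) x 1) (fun x _ => @cst_continuous _ _ 0 x)).
rewrite !mul1r => E.
transitivity (\int[mu]_(x in `[a, b]) (cst 1 x * du x)).
  by apply: eq_Rintegral => x _; rewrite mul1r.
have -> : \int[mu]_(x in `[a, b]) (cst 1 x * du x) =
  u b - u a - \int[mu]_(x in `[a, b]) (0 : R).
  by rewrite E; congr (_ - _); apply: eq_Rintegral => x _; rewrite mul0r.
by rewrite /Rintegral integral0 subr0.
Qed.

Lemma weak_derivative_unique (u du dv : R -> R) :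
  H1_pair u du -> H1_pair u dv -> {ae mu, forall x, du x = dv x}.
Proof.
move=> udu udv.
have [[_ _ du2 _] [_ _ dv2 _]] := (udu, udv).
pose d x := du x - dv x.
have d0 (a b : R) : a < b -> \int[mu]_(x in `[a, b]) d x = 0.
  move=> ab; rewrite RintegralB//; try exact: Lfun2_integrable_itv.
  by rewrite !(weak_derivative_itv u)// subrr.
have id (a b : R) : mu.-integrable `[a, b] (EFin \o d).
  by apply: integrableBR => //; exact: Lfun2_integrable_itv.
have locd : locally_integrable setT d.
  by apply: locally_integrableB; exact: Lfun2_locally_integrable.
(* Lebesgue differentiation needs a base point to the left of x. Using all base points -m, countably
   many, keeps the exceptional set null and serves every x. *)
have := ae_foralln (fun m : nat =>
  @FTC1 R d (BLeft (- m%:R)) (fun y => id _ y) locd).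
apply: filterS => x Hx; apply/eqP; rewrite -subr_eq0; apply/eqP.
pose m := (Num.truncn `|x|).+1.
have mx : - m%:R < x.
  have := truncnS_gt `|x|; rewrite -/m => xm.
  by rewrite ltrNl; apply: le_lt_trans xm; rewrite -normrN ler_norm.
have [|_] := Hx m; first by rewrite /= lte_fin.
rewrite -/(d x) => <-; rewrite derive1E.
(* The primitive of [d] from -m is 0 at every point to the right of -m, hence near x, and so is its
   derivative at x. *)
rewrite (@near_eq_derive _ _ _ _ (cst (0:R))) ?derive_cst//.
near=> y; apply: d0.
by near: y; exact: lt_nbhsr.
Unshelve. all: by end_near. Qed.

End weak_derivative.

(** * Square-integrable functions *)

Section Lfun2.
Variable R : realType.
Notation mu := (@lebesgue_measure R).

(** The value at 0 is 1, so that the absolute value is 1 everywhere and 0 belongs to the right half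
    line. *)
Definition sgn (x : R) : R := if x < 0 then -1 else 1.

Lemma measurable_sgn : measurable_fun setT sgn.
Proof.
apply: measurable_fun_ifT => //.
exact: measurable_fun_ltr.
Qed.

Lemma normr_sgn x : `|sgn x| = 1.
Proof. by rewrite /sgn; case: ifP; rewrite ?normrN normr1. Qed.

Lemma Lfun2_integrable (f : R -> R) : measurable_fun setT f ->
  mu.-integrable setT (EFin \o (fun x => f x ^+ 2)) -> f \in Lfun mu 2%:E.
Proof.
move=> mf /integrableP[_ f2].
rewrite inE; apply/andP; split; rewrite inE//=.
rewrite /finite_norm unlock; apply: poweR_lty.
apply: le_lt_trans f2; rewrite le_eqVlt; apply/orP; left; apply/eqP.
by apply: eq_integral => x _ /=; rewrite powR_mulrn// normrX.
Qed.

Lemma Lfun2_le (M : R) (f h : R -> R) : measurable_fun setT f ->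
  (forall x, `|f x| <= M * `|h x|) -> h \in Lfun mu 2%:E -> f \in Lfun mu 2%:E.
Proof.
move=> mf fh h2; apply: Lfun2_integrable => //.
apply: (le_integrableR _ _ _ (fun x => M ^+ 2 * h x ^+ 2)) => //.
- exact: measurable_funX.
- move=> x _; rewrite normrX -[h x ^+ 2]real_normK ?num_real// -exprMn.
  by rewrite ler_pXn2r ?nnegrE// (le_trans _ (fh x)).
- by apply: integrableZR => //; exact: Lfun2_integrable_sqr.
Qed.

Lemma Lfun2_mul_integrable (f h : R -> R) : f \in Lfun mu 2%:E ->
  h \in Lfun mu 2%:E -> mu.-integrable setT (EFin \o (fun x => f x * h x)).
Proof. by move=> f2 h2; apply/Lfun1_integrable; exact: Lfun2_mul_Lfun1. Qed.

End Lfun2.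

(** * Integration by parts over the whole line for an odd function with a jump at 0 *)

Section H1_odd_extension.
Variables (R : realType) (phi dphi g g' : R -> R).
Notation mu := (@lebesgue_measure R).
Hypothesis phiH1 : H1_pair phi dphi.
Hypothesis dg : forall x : R, 0 <= x -> is_derive x 1 g (g' x).
Hypothesis cg' : forall x : R, 0 <= x -> {for x, continuous g'}.
Hypothesis g2 : (fun x : R => g `|x|) \in Lfun mu 2%:E.
Hypothesis g'2 : (fun x : R => g' `|x|) \in Lfun mu 2%:E.

(** Starting from 1 rather than 0 keeps [box], whose height is 1 / N n, bounded by 1. *)
Let N (n : nat) : R := n.+1%:R.
Let N_gt0 n : 0 < N n. Proof. by rewrite ltr0n. Qed.

(* A cutoff vanishing at -N and N leaves no boundary term there; [box] carries
   its derivative. *)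
Let hat n (x : R) : R := Num.max 0 (1 - `|x| / N n).

Let box n (x : R) : R := \1_(`[- N n, N n]%classic) x / N n.

Let hat_in n x : - N n <= x <= N n -> hat n x = 1 - `|x| / N n.
Proof.
rewrite -ler_norml => xN; rewrite /hat; apply/max_idPr.
by rewrite subr_ge0 ler_pdivrMr// mul1r.
Qed.

Let hat_out n x : ~ `[- N n, N n]%classic x -> hat n x = 0.
Proof.
rewrite /= in_itv/= -ler_norml => /negP; rewrite -ltNge => xN.
by apply/max_idPl; rewrite subr_le0 ler_pdivlMr// mul1r ltW.
Qed.

Let box_in n x : - N n <= x <= N n -> box n x = (N n)^-1.
Proof. by move=> xN; rewrite /box indicE mem_set ?mul1r//= in_itv. Qed.

Let box_out n x : ~ `[- N n, N n]%classic x -> box n x = 0.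
Proof. by move=> xN; rewrite /box indicE memNset ?mul0r. Qed.

Let near_N (e : R) : \forall n \near \oo, e <= N n.
Proof.
near=> n; apply: (@le_trans _ _ n%:R); last by rewrite ler_nat.
by near: n; exact: nbhs_infty_ger.
Unshelve. all: by end_near. Qed.

Let invN_cvg0 : (fun n => (N n)^-1) @ \oo --> (0 : R).
Proof. exact: cvg_harmonic. Qed.

Let hat_cvg x : hat ^~ x @ \oo --> (1 : R).
Proof.
have L : (fun n => 1 - `|x| / N n) @ \oo --> (1 : R).
  rewrite -[X in _ --> X]subr0 -[X in _ - X](mulr0 `|x|).
  by apply: cvgB; [exact: cvg_cst|apply: cvgMr].
apply: cvg_trans L; apply: near_eq_cvg; near=> n.
rewrite hat_in// -ler_norml; near: n; exact: near_N.
Unshelve. all: by end_near. Qed.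

Let box_cvg x : box ^~ x @ \oo --> (0 : R).
Proof.
apply: cvg_trans invN_cvg0; apply: near_eq_cvg; near=> n.
rewrite box_in// -ler_norml; near: n; exact: near_N.
Unshelve. all: by end_near. Qed.

Let measurable_hat n : measurable_fun setT (hat n).
Proof.
apply: measurable_maxr; first exact: measurable_cst.
by apply: measurable_funB => //; exact: measurable_funM.
Qed.

Let measurable_box n : measurable_fun setT (box n).
Proof. by apply: measurable_funM => //; exact: measurable_indic. Qed.

Let hat_le1 n x : `|hat n x| <= 1.
Proof.
rewrite ger0_norm ?le_max ?lexx// ge_max ler01/= lerBlDr lerDl.
by rewrite divr_ge0// ltW.
Qed.

Let box_le1 n x : `|box n x| <= 1.
Proof.
rewrite /box normrM normfV [`|N n|]gtr0_norm// ler_pdivrMr// mul1r indicE.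
by apply: (@le_trans _ _ 1); [case: (_ \in _); rewrite ?normr1 ?normr0|rewrite ler1n].
Qed.

(** Dominated convergence with bound the absolute value of [F]; it serves for [hat] with l = 1 and
    for [box] with l = 0. *)
Let mul_cvg (F : R -> R) (c : nat -> R -> R) (l : R) :
  mu.-integrable setT (EFin \o F) -> (forall n, measurable_fun setT (c n)) ->
  (forall n x, `|c n x| <= 1) -> (forall x, c ^~ x @ \oo --> l) ->
  (fun n => \int[mu]_x (F x * c n x)) @ \oo --> \int[mu]_x (F x * l).
Proof.
move=> iF mc c1 cl.
apply: (@Rintegral_dominated_cvg R setT (fun n x => F x * c n x) _
  (fun x => `|F x|)) => //.
- move=> n; apply: measurable_funM => //.
  by move: iF => /measurable_int/measurable_EFinP.
- by move=> x _; apply: cvgMr.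
- exact: integrable_norm.
- by move=> n x _; rewrite normrM ler_piMr.
Qed.

(** With m = N n, the factor 1 - e y / m is [hat] on [0, N n] for e = 1 and on [- N n, 0] for e =
    -1. *)
Let is_derive_hat (f : R -> R) (df e m x : R) : is_derive x 1 f df ->
  is_derive x 1 (fun y => f y * (1 - e * y / m)) (df * (1 - e * x / m) - e * (f x / m)).
Proof.
move=> fdf.
have D : is_derive x 1 (fun y : R => 1 - e * y / m) (- (e / m)).
  by apply: is_derive_eq; rewrite /GRing.scale /=; ring.
have := @is_deriveM R R^o f _ x 1 _ _ fdf D.
by move=> /is_derive_eq; apply; rewrite /GRing.scale /=; ring.
Qed.

Let continuous_hat (f f' : R -> R) (e m x : R) :
  {for x, continuous f'} -> {for x, continuous f} ->
  {for x, continuous (fun y => f' y * (1 - e * y / m) - e * (f y / m))}.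
Proof.
move=> cf' cf; apply: cvgB.
  apply: cvgM => //; apply: cvgB; first exact: cvg_cst.
  by apply: cvgMl; apply: cvgMr.
by apply: cvgMr; apply: cvgMl.
Qed.

Let cg x : 0 <= x -> {for x, continuous g}.
Proof. by move=> /dg; exact: is_derive_continuous. Qed.

Let right n : \int[mu]_(x in `[0, N n]) (g x * (1 - 1 * x / N n) * dphi x) =
  - (g 0 * phi 0) -
  \int[mu]_(x in `[0, N n]) ((g' x * (1 - 1 * x / N n) - 1 * (g x / N n)) * phi x).
Proof.
have D (x : R) : 0 <= x <= N n -> is_derive x 1 (fun y => g y * (1 - 1 * y / N n))
    (g' x * (1 - 1 * x / N n) - 1 * (g x / N n)).
  by move=> /andP[x0 _]; apply: is_derive_hat; exact: dg.
have C (x : R) : 0 <= x <= N n ->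
    {for x, continuous (fun y => g' y * (1 - 1 * y / N n) - 1 * (g y / N n))}.
  by move=> /andP[x0 _]; apply: continuous_hat; [exact: cg'|exact: cg].
rewrite (H1_integration_by_parts R phi dphi _ _ 0 (N n) (N_gt0 n) phiH1 D C).
by rewrite mul1r divff ?gt_eqF// mulr0 mul0r subrr mulr0 !mul0r subr0 mulr1 sub0r.
Qed.

(** Here the odd reflection - g (- x), with derivative g' (- x), replaces g. Its boundary term at 0
    has the same sign as the one on the right, so the two add up instead of cancelling. *)
Let left n : \int[mu]_(x in `[- N n, 0]) (- g (- x) * (1 - -1 * x / N n) * dphi x) =
  - (g 0 * phi 0) -
  \int[mu]_(x in `[- N n, 0])
    ((g' (- x) * (1 - -1 * x / N n) - -1 * (- g (- x) / N n)) * phi x).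
Proof.
have Dg (x : R) : x <= 0 -> is_derive x 1 (fun y => - g (- y)) (g' (- x)).
  rewrite -oppr_ge0 => /dg gx.
  have := @is_derive1_comp R g -%R x _ _ gx (is_deriveNid x 1).
  rewrite mulrN1 => h; have := is_deriveN h; rewrite opprK; exact.
have D (x : R) : - N n <= x <= 0 ->
    is_derive x 1 (fun y => - g (- y) * (1 - -1 * y / N n))
      (g' (- x) * (1 - -1 * x / N n) - -1 * (- g (- x) / N n)).
  by move=> /andP[_ x0]; apply: (is_derive_hat (fun y => - g (- y))); exact: Dg.
have C (x : R) : - N n <= x <= 0 -> {for x, continuous
    (fun y => g' (- y) * (1 - -1 * y / N n) - -1 * (- g (- y) / N n))}.
  move=> /andP[_ x0]; apply: (continuous_hat (fun y => - g (- y)) (fun y => g' (- y))).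
    apply: (@continuous_comp _ _ _ -%R g'); first exact: oppr_continuous.
    by apply: cg'; rewrite oppr_ge0.
  exact: (is_derive_continuous _ _ _ _ (Dg x x0)).
have Nn0 : - N n < 0 by rewrite oppr_lt0.
rewrite (H1_integration_by_parts R phi dphi _ _ (- N n) 0 Nn0 phiH1 D C).
have -> : 1 - -1 * - N n / N n = 0.
  by rewrite mulN1r opprK divff ?subrr// gt_eqF.
by rewrite mulr0 mul0r !subr0 oppr0; ring.
Qed.

Let phi2 : phi \in Lfun mu 2%:E. Proof. by case: phiH1. Qed.
Let dphi2 : dphi \in Lfun mu 2%:E. Proof. by case: phiH1. Qed.

Let odd2 : (fun x => sgn R x * g `|x|) \in Lfun mu 2%:E.
Proof.
apply: (Lfun2_le _ 1 _ _ _ _ g2).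
  by apply: measurable_funM; [exact: measurable_sgn|exact: Lfun_measurable g2].
by move=> x; rewrite normrM normr_sgn.
Qed.

Let total n : \int[mu]_x (sgn R x * g `|x| * dphi x * hat n x) =
  - (2 * g 0 * phi 0) - (\int[mu]_x (g' `|x| * phi x * hat n x) -
                         \int[mu]_x (g `|x| * phi x * box n x)).
Proof.
have iM (F c : R -> R) : mu.-integrable setT (EFin \o F) ->
    measurable_fun setT c -> (forall x, `|c x| <= 1) ->
    mu.-integrable setT (EFin \o (fun x => F x * c x)).
  by move=> iF mc c1; apply: (integrable_mul_bounded R setT F c 1).
have i1 := iM _ _ (Lfun2_mul_integrable _ _ _ odd2 dphi2)
  (measurable_hat n) (hat_le1 n).
have i2 := iM _ _ (Lfun2_mul_integrable _ _ _ g'2 phi2)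
  (measurable_hat n) (hat_le1 n).
have i3 := iM _ _ (Lfun2_mul_integrable _ _ _ g2 phi2)
  (measurable_box n) (box_le1 n).
rewrite -RintegralB//.
rewrite (Rintegral_support _ `[- N n, N n]%classic) => [|x xN]; last first.
  by rewrite hat_out ?mulr0.
rewrite (Rintegral_support _ `[- N n, N n]%classic
  (fun x => _ - _)) => [|x xN]; last first.
  by rewrite hat_out// box_out// !mulr0 subrr.
have FL1 x : - N n <= x < 0 -> sgn R x * g `|x| * dphi x * hat n x =
    - g (- x) * (1 - -1 * x / N n) * dphi x.
  move=> /andP[xN x0]; rewrite hat_in ?xN/= ?(le_trans (ltW x0)) ?ltW//.
  by rewrite /sgn x0 ltr0_norm//; ring.
have FL2 x : - N n <= x < 0 ->
    g' `|x| * phi x * hat n x - g `|x| * phi x * box n x =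
    (g' (- x) * (1 - -1 * x / N n) - -1 * (- g (- x) / N n)) * phi x.
  move=> /andP[xN x0].
  rewrite hat_in ?box_in ?xN/= ?(le_trans (ltW x0)) ?ltW//.
  by rewrite ltr0_norm//; ring.
have FR1 x : 0 <= x <= N n -> sgn R x * g `|x| * dphi x * hat n x =
    g x * (1 - 1 * x / N n) * dphi x.
  move=> /andP[x0 xN]; rewrite hat_in ?xN ?andbT ?(le_trans _ x0) ?oppr_le0 ?ltW//.
  by rewrite /sgn ltNge x0 ger0_norm//=; ring.
have FR2 x : 0 <= x <= N n ->
    g' `|x| * phi x * hat n x - g `|x| * phi x * box n x =
    (g' x * (1 - 1 * x / N n) - 1 * (g x / N n)) * phi x.
  move=> /andP[x0 xN].
  rewrite hat_in ?box_in ?xN ?andbT ?(le_trans _ x0) ?oppr_le0 ?ltW//.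
  by rewrite ger0_norm//=; ring.
have i4 := integrableBR _ _ _ _ measurableT i2 i3.
have onN F : mu.-integrable setT (EFin \o F) ->
    mu.-integrable `[- N n, N n] (EFin \o F) by exact: integrableS.
rewrite (Rintegral_itv_split0 _ _ _ _ _ (N_gt0 n) (onN _ i1) FL1 FR1).
rewrite (Rintegral_itv_split0 _ _ _ _ _ (N_gt0 n) (onN _ i4) FL2 FR2).
by rewrite left right; ring.
Qed.

(** The odd extension of [g] jumps by 2 g 0 at the origin, and this jump is the only boundary term:
    the cutoff removes those at -N and N, and its own derivative disappears in the limit. *)
Theorem H1_odd_extension_by_parts :
  \int[mu]_x (sgn R x * g `|x| * dphi x) =
  - (2 * g 0 * phi 0) - \int[mu]_x (g' `|x| * phi x).
Proof.
have L1 := mul_cvg _ hat 1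
  (Lfun2_mul_integrable _ _ _ odd2 dphi2) measurable_hat hat_le1 hat_cvg.
have L2 := mul_cvg _ hat 1
  (Lfun2_mul_integrable _ _ _ g'2 phi2) measurable_hat hat_le1 hat_cvg.
have L3 := mul_cvg _ box 0
  (Lfun2_mul_integrable _ _ _ g2 phi2) measurable_box box_le1 box_cvg.
pose Z n := \int[mu]_x (sgn R x * g `|x| * dphi x * hat n x).
have ZL : Z @ \oo --> \int[mu]_x (sgn R x * g `|x| * dphi x * 1) by exact: L1.
have ZR : Z @ \oo --> - (2 * g 0 * phi 0) -
    (\int[mu]_x (g' `|x| * phi x * 1) - \int[mu]_x (g `|x| * phi x * 0)).
  rewrite /Z; under eq_fun do rewrite total.
  by apply: cvgB; [exact: cvg_cst|exact: cvgB].
have := @cvg_unique R (@Rhausdorff R) (Z @ \oo) _ _ _ ZL ZR.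
move=> E; transitivity (\int[mu]_x (sgn R x * g `|x| * dphi x * 1)).
  by apply: eq_Rintegral => x _; rewrite mulr1.
rewrite E.
have -> : \int[mu]_x (g `|x| * phi x * 0) = \int[mu]_x (0 : R).
  by apply: eq_Rintegral => x _; rewrite mulr0.
have -> : \int[mu]_x (0 : R) = 0 by rewrite /Rintegral integral0.
rewrite subr0; congr (_ - _).
by apply: eq_Rintegral => x _; rewrite mulr1.
Qed.

End H1_odd_extension.

(** * Even profiles *)

Section even_extension.
Variables (R : realType) (f f' : R -> R).
Notation mu := (@lebesgue_measure R).
Hypothesis df : forall x : R, 0 <= x -> is_derive x 1 f (f' x).
Hypothesis cf' : forall x : R, 0 <= x -> {for x, continuous f'}.

Let cf x : 0 <= x -> {for x, continuous f}.
Proof. by move=> /df; exact: is_derive_continuous. Qed.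

Lemma continuous_comp_normr (h : R -> R) :
  (forall x : R, 0 <= x -> {for x, continuous h}) -> continuous (fun x : R => h `|x|).
Proof.
move=> ch x; apply: (@continuous_comp _ _ _ (fun y : R => `|y|) h).
  exact: norm_continuous.
exact: ch.
Qed.

(** On each half line the sum of the two integrands is the derivative of the extension times psi.
    The boundary values at 0 are equal and cancel because an even extension is continuous there; far
    out psi vanishes. *)
Lemma even_extension_weak_derivative :
  weak_derivative (fun x : R => f `|x|) (fun x => sgn R x * f' `|x|).
Proof.
move=> psi [dpsi cpsi' cpt].
have [M [_ PM]] := compact_bounded cpt.
pose N := `|M| + 1; have N0 : 0 < N by rewrite ltr_pwDr.
have psi0 x : N < `|x| -> psi x = 0.
  move=> Nx; apply/eqP; apply: contraTT Nx => psix; rewrite -leNgt.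
  have := PM N; rewrite /N => /(_ _ x); apply.
    by rewrite (le_lt_trans (ler_norm M))// ltrDl.
  exact: subset_closure.
(* [psi] is known to vanish only strictly beyond N; the extra unit makes it vanish at the endpoints
   -L and L too. *)
pose L := N + 1; have L0 : 0 < L by rewrite addr_gt0.
have psiL x : N < `|x| -> derive1 psi x = 0.
  move=> Nx; rewrite derive1E (@near_eq_derive _ _ _ _ (cst (0:R))) ?derive_cst//.
  near=> y; apply: psi0; near: y.
  have : `|y| @[y --> x] --> `|x| by exact: norm_continuous.
  by move/cvgrPdist_lt => /(_ (`|x| - N)); rewrite subr_gt0 => /(_ Nx);
    apply: filterS => y; rewrite ltr_distlC => /andP[+ _]; lra.
have out x : ~ `[- L, L]%classic x -> N < `|x|.
  rewrite /= in_itv/= -ler_norml => /negP; rewrite -ltNge.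
  by apply: lt_trans; rewrite ltrDl.
have cpsi : continuous psi.
  by move=> x; apply/differentiable_continuous/derivable1_diffP; exact: dpsi.
have cu := continuous_comp_normr _ cf.
have cf'' := continuous_comp_normr _ cf'.
have i1 : mu.-integrable `[- L, L] (EFin \o (fun x => f `|x| * derive1 psi x)).
  by apply: continuous_itv_integrable => x _; apply: cvgM; [exact: cu|exact: cpsi'].
have i2 : mu.-integrable `[- L, L] (EFin \o (fun x => sgn R x * f' `|x| * psi x)).
  have i3 : mu.-integrable `[- L, L] (EFin \o (fun x => f' `|x| * psi x)).
    by apply: continuous_itv_integrable => x _; apply: cvgM; [exact: cf''|exact: cpsi].
  have := integrable_mul_bounded R `[- L, L]%classic _ (sgn R) 1 (measurable_itv _) i3.
  have -> : (fun x => f' `|x| * psi x * sgn R x) = (fun x => sgn R x * f' `|x| * psi x).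
    by apply/funext => x; ring.
  apply; first exact: measurable_funTS (measurable_sgn R).
  by move=> x _; rewrite normr_sgn.
rewrite (Rintegral_support _ `[- L, L]%classic) => [|x /out xo]; last first.
  by rewrite psiL// mulr0.
rewrite (Rintegral_support _ `[- L, L]%classic
  (fun x => sgn R x * _ * _)) => [|x /out xo];
  last by rewrite psi0// mulr0.
apply/eqP; rewrite -subr_eq0 opprK -RintegralD//; apply/eqP.
rewrite (Rintegral_itv_split0 R L _
  (fun x => - f' (- x) * psi x + f (- x) * derive1 psi x)
  (fun x => f' x * psi x + f x * derive1 psi x)
  L0 (integrableDR _ _ _ _ (measurable_itv _) i1 i2)).
- have DL (x : R) : - L <= x <= 0 -> is_derive x 1 (fun y => f (- y) * psi y)
      (- f' (- x) * psi x + f (- x) * derive1 psi x).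
    move=> /andP[_ x0].
    have fx := @is_derive1_comp R f -%R x _ _ (df (- x) _) (is_deriveNid x 1).
    have px : is_derive x 1 psi (derive1 psi x).
      by apply: DeriveDef => //; rewrite derive1E.
    have := @is_deriveM R R^o _ psi x 1 _ _ (fx _) px.
    by rewrite oppr_ge0 => /(_ x0) /is_derive_eq; apply; rewrite /GRing.scale /=; ring.
  have DR (x : R) : 0 <= x <= L -> is_derive x 1 (fun y => f y * psi y)
      (f' x * psi x + f x * derive1 psi x).
    move=> /andP[x0 _].
    have px : is_derive x 1 psi (derive1 psi x).
      by apply: DeriveDef => //; rewrite derive1E.
    have := @is_deriveM R R^o _ psi x 1 _ _ (df _ x0) px.
    by move=> /is_derive_eq; apply; rewrite /GRing.scale /=; ring.
  have CL (x : R) : - L <= x <= 0 ->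
      {for x, continuous (fun x => - f' (- x) * psi x + f (- x) * derive1 psi x)}.
    move=> /andP[_ x0].
    have comp (h : R -> R) : {for - x, continuous h} ->
        {for x, continuous (fun y => h (- y))}.
      by move=> ch; apply: (@continuous_comp _ _ _ -%R h) => //; exact: oppr_continuous.
    apply: cvgD; apply: cvgM => //.
    + by apply: cvgN; apply: comp; apply: cf'; rewrite oppr_ge0.
    + by apply: cpsi.
    + by apply: comp; apply: cf; rewrite oppr_ge0.
    + exact: cpsi'.
  have CR (x : R) : 0 <= x <= L ->
      {for x, continuous (fun x => f' x * psi x + f x * derive1 psi x)}.
    move=> /andP[x0 _]; apply: cvgD; apply: cvgM.
    + exact: cf'.
    + exact: cpsi.
    + exact: cf.
    + exact: cpsi'.
  have NL0 : - L < 0 by rewrite oppr_lt0.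
  rewrite (@Rintegral_derive R _ _ _ _ NL0 DL CL).
  rewrite (@Rintegral_derive R _ _ _ _ L0 DR CR).
  have NL : N < `|L| by rewrite gtr0_norm// ltrDl.
  by rewrite (psi0 L)// (psi0 (- L)) ?normrN// oppr0 !mulr0 subr0 sub0r addrN.
- by move=> x /andP[_ x0]; rewrite /sgn x0 ltr0_norm//; ring.
- by move=> x /andP[x0 _]; rewrite /sgn ltNge x0 ger0_norm//=; ring.
Unshelve. all: by end_near. Qed.

Lemma even_extension_H1 : (fun x : R => f `|x|) \in Lfun mu 2%:E ->
  (fun x : R => f' `|x|) \in Lfun mu 2%:E ->
  H1_pair (fun x : R => f `|x|) (fun x => sgn R x * f' `|x|).
Proof.
move=> f2 f'2; split => //.
- exact: continuous_comp_normr.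
- apply: (Lfun2_le _ 1 _ _ _ _ f'2).
    by apply: measurable_funM; [exact: measurable_sgn|exact: Lfun_measurable f'2].
  by move=> x; rewrite normrM normr_sgn.
- exact: even_extension_weak_derivative.
Qed.

End even_extension.

(** For an even function the one-sided derivatives at 0 are - f' 0 on the left and f' 0 on the
    right, so the jump condition reads - 2 f' 0 = |f 0|^(q-2) f 0. Integrating the odd extension of
    f' by parts produces exactly this term, and the equation on x >= 0 replaces f''. *)
Lemma even_profile_weak_solution (R : realType) (p q lambda : R)
    (f f' f'' : R -> R) :
  (forall x : R, 0 <= x -> is_derive x 1 f (f' x)) ->
  (forall x : R, 0 <= x -> is_derive x 1 f' (f'' x)) ->
  (forall x : R, 0 <= x -> {for x, continuous f''}) ->
  (fun x : R => f `|x|) \in Lfun (@lebesgue_measure R) 2%:E ->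
  (fun x : R => f' `|x|) \in Lfun (@lebesgue_measure R) 2%:E ->
  (fun x : R => signed_pow p (f `|x|)) \in Lfun (@lebesgue_measure R) 2%:E ->
  (forall x : R, 0 <= x -> f'' x = signed_pow p (f x) + lambda * f x) ->
  - (2 * f' 0) = signed_pow q (f 0) ->
  weak_solution p q lambda (fun x : R => f `|x|).
Proof.
move=> df df' cf'' f2 f'2 s2 ode jump du phi dphi udu phiH1.
set mu := @lebesgue_measure R in f2 f'2 s2 *.
have cf' (x : R) : 0 <= x -> {for x, continuous f'}.
  by move=> x0; exact: (is_derive_continuous _ _ _ _ (df' x x0)).
have udv := even_extension_H1 R f f' df cf' f2 f'2.
have [[[_ _ du2 _] [_ _ dv2 _]] [_ phi2 dphi2 _]] := (udu, udv, phiH1).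
(* [du] is an arbitrary representative; uniqueness of weak derivatives lets the explicit one take
   its place under the integral. *)
have -> : \int[mu]_x (du x * dphi x) = \int[mu]_x (sgn R x * f' `|x| * dphi x).
  congr fine; apply: ae_eq_integral => //.
  - apply/measurable_EFinP/measurable_funM.
      exact: (Lfun_measurable R _ _ du2).
    exact: (Lfun_measurable R _ _ dphi2).
  - apply/measurable_EFinP/measurable_funM.
      exact: (Lfun_measurable R _ _ dv2).
    exact: (Lfun_measurable R _ _ dphi2).
  - have := weak_derivative_unique R _ _ _ udu udv.
    apply: filterS; first exact: (ae_filter_ringOfSetsType mu).
    by move=> x /= -> _.
have f''E : (fun x : R => f'' `|x|) =
    (fun x => signed_pow p (f `|x|) + lambda * f `|x|).
  by apply/funext => x; exact: ode.
(* Square integrability of f'' is read off from the equation, whose right-hand side is a combination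
   of square-integrable functions. *)
have f''2 : (fun x : R => f'' `|x|) \in Lfun mu 2%:E.
  rewrite f''E; have p1 : (1 <= 2%:E :> \bar R)%E by rewrite lee_fin ler1n.
  have [_ addC] := Lfun_addr_closed mu p1; apply: addC => //.
  have p2 : 1 <= 2 :> R by rewrite ler1n.
  rewrite (_ : (fun x => _) = lambda \o* (fun x : R => f `|x|)).
    exact: Lfun_scale.
  by apply/funext => x; rewrite mulrC.
rewrite (H1_odd_extension_by_parts R phi dphi f' f'' phiH1 df' cf'' f'2 f''2).
have i1 := Lfun2_mul_integrable _ _ _ s2 phi2.
have i2 := Lfun2_mul_integrable _ _ _ f2 phi2.
have -> : \int[mu]_x (f'' `|x| * phi x) =
    \int[mu]_x (signed_pow p (f `|x|) * phi x) + lambda * \int[mu]_x (f `|x| * phi x).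
  rewrite -RintegralZl// -RintegralD//; last exact: integrableZR.
  by apply: eq_Rintegral => x _; rewrite ode//; ring.
by rewrite normr0 -jump; ring.
Qed.

(** * The explicit solutions for p = 4 *)

Section soliton.
Variables (R : realType) (k w : R).
Hypotheses (k0 : 0 < k) (w0 : 0 < w) (w1 : w <= 1).
Notation mu := (@lebesgue_measure R).

Let E (x : R) := expR (- (k * x)).
Let Z (x : R) := 2 - w ^+ 2 * E x ^+ 2.

Definition soliton (x : R) : R := 4 * k * w * E x * (Z x)^-1.
Definition dsoliton (x : R) : R :=
  - (4 * k ^+ 2 * w) * (E x * (2 + w ^+ 2 * E x ^+ 2)) * (Z x)^-1 ^+ 2.
(** Written as the right-hand side of the equation with lambda = k^2, so that checking it to be the
    derivative of [dsoliton] is checking the equation. *)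
Definition d2soliton (x : R) : R := k ^+ 2 * soliton x + soliton x ^+ 3.

Let E_itv x : 0 <= x -> 0 < E x <= 1.
Proof.
by move=> x0; rewrite /E expR_gt0 /= -[leRHS]expR0 ler_expR oppr_le0 mulr_ge0// ltW.
Qed.

(** For x >= 0 both w and E x are at most 1. The denominator does vanish at some negative x, which
    is why the profile is used on x >= 0 only. *)
Let Z_ge1 x : 0 <= x -> 1 <= Z x.
Proof.
move=> /E_itv /andP[E0 E1]; rewrite /Z lerBrDr -lerBrDl -exprMn.
have wE0 : 0 < w * E x by exact: mulr_gt0.
have wE1 : w * E x <= 1 by apply: mulr_ile1 => //; exact: ltW.
by nra.
Qed.

Let Z_neq0 x : 0 <= x -> Z x != 0.
Proof. by move=> /Z_ge1 Zx; rewrite gt_eqF// (lt_le_trans _ Zx). Qed.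

Let is_derive_E (x : R) : is_derive x 1 E (- k * E x).
Proof.
have D : is_derive x 1 (fun y : R => - (k * y)) (- k).
  by apply: is_derive_eq; rewrite /GRing.scale /= mulr1.
have := @is_derive1_comp R expR (fun y => - (k * y)) x _ _ (is_derive_expR _) D.
by rewrite mulrC.
Qed.

Let is_derive_Z (x : R) : is_derive x 1 Z (2 * k * w ^+ 2 * E x ^+ 2).
Proof.
have dE := is_derive_E x.
by apply: is_derive_eq; rewrite /GRing.scale /=; ring.
Qed.

Let is_derive_invZ (x : R) : 0 <= x ->
  is_derive x 1 (fun y => (Z y)^-1) (- (2 * k * w ^+ 2 * E x ^+ 2) / Z x ^+ 2).
Proof.
move=> x0; have := is_deriveV (Z_neq0 x x0) (is_derive_Z x).
by move=> /is_derive_eq; apply; rewrite /GRing.scale /=; ring.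
Qed.

Lemma is_derive_soliton (x : R) : 0 <= x -> is_derive x 1 soliton (dsoliton x).
Proof.
move=> x0; have dE := is_derive_E x; have dV := is_derive_invZ x x0.
apply: is_derive_eq; rewrite /GRing.scale /= /dsoliton.
by have := Z_neq0 x x0; rewrite /Z -exprMn => Zx; field.
Qed.

Lemma is_derive_dsoliton (x : R) : 0 <= x -> is_derive x 1 dsoliton (d2soliton x).
Proof.
move=> x0; have dE := is_derive_E x; have dV := is_derive_invZ x x0.
apply: is_derive_eq; rewrite /GRing.scale /= /d2soliton /soliton.
by have := Z_neq0 x x0; rewrite /Z -exprMn => Zx; field.
Qed.

Lemma soliton_gt0 x : 0 <= x -> 0 < soliton x.
Proof.
move=> x0; have /andP[E0 _] := E_itv x x0; have Z1 := Z_ge1 x x0.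
by rewrite /soliton !mulr_gt0// invr_gt0 (lt_le_trans _ Z1).
Qed.

(** This bound gives u^3 <= (4 k)^2 u, hence the square integrability of the cubic term. *)
Lemma soliton_le x : 0 <= x -> soliton x <= 4 * k.
Proof.
move=> x0; have /andP[E0 E1] := E_itv x x0; have Z1 := Z_ge1 x x0.
rewrite /soliton ler_pdivrMr ?(lt_le_trans _ Z1)// -!mulrA ler_pM2l// ler_pM2l//.
by apply: le_trans Z1; apply: mulr_ile1 => //; exact: ltW.
Qed.

Lemma dsolitonE x : dsoliton x =
  - k * soliton x * ((2 + w ^+ 2 * E x ^+ 2) * (Z x)^-1).
Proof. by rewrite /dsoliton /soliton; ring. Qed.

(** The quotient in [dsolitonE] is (4 - Z) / Z, at most 3 since Z >= 1. Square integrability thus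
    passes from the profile to its derivative. *)
Lemma normr_dsoliton_le x : 0 <= x -> `|dsoliton x| <= 3 * k * `|soliton x|.
Proof.
move=> x0; have Z1 := Z_ge1 x x0; have Zx0 : 0 < Z x := lt_le_trans ltr01 Z1.
have q0 : 0 <= (2 + w ^+ 2 * E x ^+ 2) * (Z x)^-1.
  by rewrite divr_ge0 ?ltW// addr_gt0// -exprMn exprn_gt0// mulr_gt0// expR_gt0.
have q3 : (2 + w ^+ 2 * E x ^+ 2) * (Z x)^-1 <= 3.
  by rewrite ler_pdivrMr//; move: Z1; rewrite /Z; lra.
rewrite dsolitonE normrM (ger0_norm q0) normrM normrN (gtr0_norm k0).
have -> : 3 * k * `|soliton x| = k * `|soliton x| * 3 by ring.
by rewrite ler_wpM2l// mulr_ge0// ltW.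
Qed.

Lemma soliton_integral :
  (\int[mu]_x (soliton `|x| ^+ 2)%:E = (8 * k * w ^+ 2 / (2 - w ^+ 2))%:E)%E.
Proof.
have cs (x : R) : 0 <= x -> {for x, continuous soliton}.
  by move=> x0; exact: (is_derive_continuous _ _ _ _ (is_derive_soliton x x0)).
rewrite ge0_symfun_integralT; first last.
- by move=> x /=; rewrite normrN.
- by move=> x; apply: (continuous_comp_normr _ (fun y => soliton y ^+ 2)) => y y0;
    apply: cvgM; exact: cs.
- by move=> x; exact: sqr_ge0.
(* Z' = 2 k w^2 E^2, so u^2 = 16 k^2 w^2 E^2 / Z^2 = 8 k Z' / Z^2. As E tends to 0 at infinity, Z
   tends to 2 and this antiderivative to - 4 k. *)
pose F (x : R) := - (8 * k) * (Z x)^-1.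
have dF (x : R) : 0 <= x -> is_derive x 1 F (soliton x ^+ 2).
  move=> x0; have dV := is_derive_invZ x x0.
  apply: is_derive_eq; rewrite /GRing.scale /= /soliton.
  by have := Z_neq0 x x0; rewrite /Z -exprMn => Zx; field.
have Fy : F x @[x --> +oo%R] --> - (8 * k) * 2^-1.
  have Ey : E x @[x --> +oo%R] --> (0 : R).
    have kx : (k * x @[x --> +oo%R] --> +oo%R).
      under eq_fun do rewrite mulrC.
      by apply: gt0_cvgMly => //; exact: cvg_id.
    exact: (cvg_comp _ _ kx (@cvgr_expR R)).
  apply: cvgMr; apply: cvgV => //.
  rewrite -[X in _ --> X]subr0 -[X in _ - X](mulr0 (w ^+ 2)).
  rewrite -[X in w ^+ 2 * X](mulr0 (0 : R)).
  by apply: cvgB; [exact: cvg_cst|apply: cvgMr; apply: cvgM].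
rewrite -set_itvcy.
have -> : (\int[mu]_(x in `[0%R, +oo[) (soliton `|x| ^+ 2)%:E =
    \int[mu]_(x in `[0%R, +oo[) (soliton x ^+ 2)%:E)%E.
  apply: eq_integral => x /[!inE]/= /[!in_itv]/= /andP[x0 _].
  by rewrite ger0_norm.
rewrite (@ge0_continuous_FTC2y R (fun x => soliton x ^+ 2) F 0 (- (8 * k) * 2^-1)).
- rewrite -EFinB -EFinM; congr EFin; rewrite /F /Z /E mulr0 oppr0 expR0 expr1n mulr1.
  have wz : 2 - w ^+ 2 != 0.
    by have := Z_neq0 0 (lexx _); rewrite /Z /E mulr0 oppr0 expR0 expr1n mulr1.
  by field.
- by move=> x _; exact: sqr_ge0.
- apply/continuous_within_itvcyP; split.
    move=> x /[!in_itv]/= /andP[x0 _]; apply: cvgM; exact: (cs x (ltW x0)).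
  by apply: cvg_at_right_filter; apply: cvgM; exact: cs.
- exact: Fy.
- by move=> x x0; have [] := dF x (ltW x0).
- by apply: cvg_at_right_filter; exact: (is_derive_continuous _ _ _ _ (dF 0 (lexx _))).
- move=> x /[!in_itv]/= /andP[x0 _]; rewrite derive1E.
  by have := dF x (ltW x0) => ?; rewrite derive_val.
Qed.

End soliton.

Lemma Lnorm2_sqr (R : realType) (f : R -> R) (m : R) :
  f \in Lfun (@lebesgue_measure R) 2%:E ->
  (\int[@lebesgue_measure R]_x (f x ^+ 2)%:E = m%:E)%E ->
  ('N[@lebesgue_measure R]_2%:E[EFin \o f] ^+ 2 = m%:E)%E.
Proof.
rewrite inE => /andP[_ /[!inE]/= fN] fm.
have Nf : ('N[@lebesgue_measure R]_2%:E[EFin \o f] \is a fin_num)%E.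
  by rewrite ge0_fin_numE// Lnorm_ge0.
rewrite -fm -(fineK Nf) -EFinM -expr2 -powR_mulrn ?fine_ge0 ?Lnorm_ge0//.
rewrite -poweR_EFin fineK// poweR_Lnorm//.
by apply: eq_integral => x _ /=; rewrite powR_mulrn// real_normK ?num_real.
Qed.

Lemma soliton_solution (R : realType) (w : R) : 0 < w -> w <= 1 ->
  (w ^+ 2 + 2) ^+ 2 = 9 * w ->
  exists2 u : R -> R, solution_at_mass 4 (7 / 2) (9 / 2) u & u 0 = 9 / (4 * w).
Proof.
move=> w0 w1 ww.
(* t is the value at 0, k is obtained by solving 4 k w / (2 - w^2) = t, and s is the square root of
   t by the equation on w. The mass is then 2 t w = 9/2. *)
pose t := 9 / (4 * w); pose s := (w ^+ 2 + 2) / (2 * w).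
pose k := t * (2 - w ^+ 2) / (4 * w).
have wn0 : w != 0 by rewrite gt_eqF.
have w2 : 0 < 2 - w ^+ 2 by nra.
have t0 : 0 < t by rewrite divr_gt0// mulr_gt0.
have k0 : 0 < k by rewrite /k divr_gt0 ?(mulr_gt0 t0)// mulr_gt0.
have s0 : 0 < s by rewrite divr_gt0 ?mulr_gt0// addr_gt0// exprn_gt0.
have ts : t = s ^+ 2 by rewrite /s expr_div_n ww /t; field.
have w2n0 : 2 - w ^+ 2 != 0 by rewrite gt_eqF.
have f0 : soliton R k w 0 = t.
  rewrite /soliton mulr0 oppr0 expR0 expr1n !mulr1 /k; field.
  by rewrite w2n0 wn0.
have f'0 : dsoliton R k w 0 = - (t ^+ 2 * s / 2).
  rewrite /dsoliton mulr0 oppr0 expR0 expr1n !mulr1 !mul1r /k /s; field.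
  by rewrite w2n0 wn0.
have df := is_derive_soliton R k w k0 w0 w1.
have df' := is_derive_dsoliton R k w k0 w0 w1.
have cf (x : R) : 0 <= x -> {for x, continuous (soliton R k w)}.
  by move=> x0; exact: (is_derive_continuous _ _ _ _ (df x x0)).
have cf' (x : R) : 0 <= x -> {for x, continuous (dsoliton R k w)}.
  by move=> x0; exact: (is_derive_continuous _ _ _ _ (df' x x0)).
have cu := continuous_comp_normr R _ cf.
have uint : (\int[@lebesgue_measure R]_x (soliton R k w `|x| ^+ 2)%:E = (9 / 2)%:E)%E.
  rewrite soliton_integral//; congr EFin.
  transitivity (2 * t * w); first by rewrite /k; field; rewrite w2n0 wn0.
  by rewrite /t; field.
have u2 : (fun x : R => soliton R k w `|x|) \in Lfun (@lebesgue_measure R) 2%:E.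
  apply: Lfun2_integrable; first exact: continuous_measurable_fun.
  apply/integrableP; split.
    apply/measurable_EFinP/measurable_funX; exact: continuous_measurable_fun.
  under eq_integral do rewrite /= ger0_norm ?sqr_ge0//.
  by rewrite uint ltry.
have u'2 : (fun x : R => dsoliton R k w `|x|) \in Lfun (@lebesgue_measure R) 2%:E.
  apply: (Lfun2_le R (3 * k) _ _ _ _ u2).
    by apply: continuous_measurable_fun; exact: continuous_comp_normr.
  by move=> x; exact: normr_dsoliton_le.
have pow4 (x : R) : 0 <= x -> signed_pow 4 (soliton R k w x) = soliton R k w x ^+ 3.
  move=> x0; have fx := soliton_gt0 R k w k0 w0 w1 x x0.
  rewrite /signed_pow (_ : 4 - 2 = 2%:R); last by ring.
  by rewrite powR_mulrn// gtr0_norm//; ring.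
have s2 : (fun x : R => signed_pow 4 (soliton R k w `|x|)) \in
    Lfun (@lebesgue_measure R) 2%:E.
  have -> : (fun x : R => signed_pow 4 (soliton R k w `|x|)) =
      (fun x => soliton R k w `|x| ^+ 3) by apply/funext => x; exact: pow4.
  apply: (Lfun2_le R ((4 * k) ^+ 2) _ _ _ _ u2).
    by apply: measurable_funX; exact: continuous_measurable_fun.
  move=> x; have fx := soliton_gt0 R k w k0 w0 w1 `|x| (normr_ge0 x).
  have fk := soliton_le R k w k0 w0 w1 `|x| (normr_ge0 x).
  rewrite /= normrX gtr0_norm// exprSr ler_pM2r// ler_pXn2r// nnegrE ltW//.
  by rewrite mulr_gt0.
have jump : - (2 * dsoliton R k w 0) = signed_pow (7 / 2) (soliton R k w 0).
  (* Both sides are t^(5/2): since t = s^2, the real power t^(3/2) is s^3, while - 2 f' 0 = t^2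
     s. *)
  rewrite f0 f'0 /signed_pow gtr0_norm// [X in X `^ _]ts.
  rewrite -powR_mulrn ?ltW// -powRrM (_ : 2 * (7 / 2 - 2) = 3); last by field.
  by rewrite powR_mulrn ?ltW// ts; field.
exists (fun x => soliton R k w `|x|); last by rewrite normr0.
split.
- exists (fun x => sgn R x * dsoliton R k w `|x|).
  exact: even_extension_H1.
- exists (k ^+ 2); first exact: sqr_ge0.
  apply: (even_profile_weak_solution R _ _ _ _ _ (d2soliton R k w) df df') => //.
  + move=> x x0; apply: cvgD; first by apply: cvgMr; exact: cf.
    by apply: cvgM; [exact: cf|apply: cvgM; exact: cf].
  + by move=> x x0; rewrite /d2soliton pow4// addrC.
- exact: Lnorm2_sqr.
Qed.

Theorem theorem1p3 (R : realType) :
  exists p q mu : R,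
    [/\ 2 < p, 2 < q,
        (6 < p /\ 4 < q < p / 2 + 1) \/ (2 < p < 6 /\ p / 2 + 1 < q < 4),
        0 < mu &
        exists u1 u2 : R -> R,
          [/\ solution_at_mass p q mu u1,
              solution_at_mass p q mu u2,
              u1 <> u2 &
              u1 <> (fun x : R => - u2 x)]].
Proof.
(* (w^2 + 2)^2 - 9 w is (w - 1) times this cubic; the root w = 1 gives the first solution. The cubic
   is -9/8 at 1/2 and 3 at 1, so it has a root in [1/2, 1), which gives the second. *)
pose P : {poly R} := 'X^3 + 'X^2 + 5%:P * 'X - 4%:P.
have PE x : P.[x] = x ^+ 3 + x ^+ 2 + 5 * x - 4 by rewrite /P !hornerE.
have half1 : 2^-1 <= 1 :> R by lra.
have [w /andP[w_ge w_le] /rootP] : exists2 x, 2^-1 <= x <= 1 & root P x.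
  by apply: poly_ivt half1 _; rewrite !PE; apply/andP; split; lra.
rewrite PE => Pw.
have w0 : 0 < w by lra.
have w1 : w < 1.
  rewrite lt_neqAle w_le andbT; apply/eqP => E; move: Pw; rewrite E !expr1n; lra.
have ww : (w ^+ 2 + 2) ^+ 2 = 9 * w by nra.
have [u1 u1s u10] := soliton_solution R 1 ltr01 (lexx _) ltac:(ring).
have [u2 u2s u20] := soliton_solution R w w0 w_le ww.
have u20_gt : 9 / 4 < u2 0.
  rewrite u20 ltr_pdivlMr ?mulr_gt0//; lra.
exists 4, (7 / 2), (9 / 2); split; [lra|lra|right; split; lra|lra|].
(* At 0 the first solution is 9/4 and the second is larger, in particular positive; this rules out
   both equality and opposite signs. *)
exists u1, u2; split => // E; have := congr1 (fun f => f 0) E; rewrite u10; lra.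
Qed.
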